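(* Let $X_n$ be the number of correct guesses (under the optimal strategy, with complete feedback) for a deck of $n$ cards labeled $1,\dots,n$ that has been riffle shuffled exactly once. Then the normalized random variable $Y_n=(X_n-\frac{n}{2})/\sqrt{n}$ converges in distribution, as $n\to\infty$, to a (generalized gamma distributed) random variable $G$ with probability density function $$f(x)=\sqrt{\frac{2}{\pi}}\cdot 8x^2e^{-2x^2},\quad x\ge 0.$$
   Context: One-time riffle shuffle (Gilbert–Shannon–Reeds model): an ordered deck $1,2,\dots,n$ is cut after the first $k$ cards with probability $\binom{n}{k}/2^n$, $0\le k\le n$, and the two packets $1,\dots,k$ and $k+1,\dots,n$ are interleaved uniformly at random, keeping the relative order within each packet. Equivalently: choose a word $w\in\{a,b\}^n$ uniformly at random among the $2^n$ words; if $w$ has $k$ letters $a$, replace the $a$'s from left to right by $1,2,\dots,k$ and the $b$'s from left to right by $k+1,\dots,n$; the resulting sequence $\sigma=(\sigma_1,\dots,\sigma_n)$ is the shuffled deck read from top to bottom. Guessing game with complete feedback: the cards are drawn one after another from the top; before each draw the guesser guesses the label of the next card, and then the drawn card is shown. The guesser uses the optimal strategy (maximizing the number of correct guesses): as long as all previous guesses were correct, the guesser guesses label $j$ for the $j$-th card. When this fails for the first time, say the $j$-th card has label $m>j$, the cut is known to have been at $m-1$, and the remaining cards form an interleaving of the two increasing sequences $j,j+1,\dots,m-1$ and $m+1,\dots,n$; from then on the guesser always guesses the smallest remaining label of the currently longer of the two remaining sequences (in case of equal lengths, either choice). $X_n$ denotes the total number of correct guesses, with $X_0=0$. *)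

(* Defs.v *)
From HB Require Import structures.
From mathcomp Require Import all_boot all_order all_algebra.
From mathcomp Require Import all_classical all_reals all_analysis.

Set Implicit Arguments.
Unset Strict Implicit.
Unset Printing Implicit Defensive.

Import Order.TTheory GRing.Theory Num.Theory.
Import numFieldNormedType.Exports.

Local Open Scope classical_set_scope.
Local Open Scope ring_scope.

(* A word over {a, b} is a sequence of booleans, with [true] standing for a.
   [fill i j w] replaces the a's of w from left to right by i, i + 1, ... and
   the b's from left to right by j, j + 1, ... *)
Fixpoint fill (i j : nat) (w : seq bool) : seq nat :=
  match w with
  | [::] => [::]
  | true :: w' => i :: fill i.+1 j w'
  | false :: w' => j :: fill i j.+1 w'
  end.

(* With k letters a in w, this is the deck 1, ..., size w cut after the first k
   cards and interleaved according to w, read from top to bottom. *)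
Definition riffle (w : seq bool) : seq nat := fill 1 (count id w).+1 w.

(* The label guessed for the next card of a deck of n cards when h is the
   sequence of the cards shown so far. The index i is the first one (from 0) at
   which the card drawn was not the one guessed; the labels not yet drawn
   then form the increasing sequences [low] (below m) and [high] (above m).
   When these have equal lengths, the choice is left to [tie], which may depend
   on everything the guesser has seen. *)
Definition guess (n : nat) (tie : seq nat -> bool) (h : seq nat) : nat :=
  let i := find (fun i => nth 0%N h i != i.+1) (iota 0 (size h)) in
  if i == size h then (size h).+1 else
  let j := i.+1 in
  let m := nth 0%N h i in
  let low := [seq x <- iota j (m - j) | x \notin h] in
  let high := [seq x <- iota m.+1 (n - m) | x \notin h] in
  if (size high < size low)%N then head 0%N low
  else if (size low < size high)%N then head 0%N high
  else if tie h then head 0%N low else head 0%N high.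

Definition correct_guesses (tie : seq nat -> bool) (s : seq nat) : nat :=
  \sum_(0 <= t < size s) (guess (size s) tie (take t s) == nth 0%N s t).

Lemma measurable_tuple_bool (n : nat) (A : set (n.-tuple bool)) : measurable A.
Proof.
have -> : A = \bigcup_(u in A) [set u] by rewrite (bigcup_imset1 A id) image_id.
apply: fin_bigcup_measurable.
  exact: finite_finset.
move=> u _.
have -> : [set u] = \bigcap_(i in [set: 'I_n])
    ((@tnth n bool) ^~ i @^-1` [set tnth u i]).
  by apply/seteqP; split=> [_ -> //|v /= uv]; apply: eq_from_tnth => i; exact: uv.
apply: fin_bigcap_measurable => [|i _]; first exact: finite_finset.
by rewrite -[X in measurable X]setTI; exact: measurable_tnth.
Qed.

Section random_riffle.
Context {R : realType} {d : measure_display} {T : measurableType d}.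
Context {P : probability T R} {n : nat}.
Implicit Types (w : {RV P >-> n.-tuple bool}) (tie : seq nat -> bool).

Definition uniform_word w : Prop :=
  forall u : n.-tuple bool, P (w @^-1` [set u]) = ((2 ^- n)%:E)%E.

Definition num_correct w tie (omega : T) : nat :=
  correct_guesses tie (riffle (w omega)).

Definition normalized_correct w tie (omega : T) : R :=
  ((num_correct w tie omega)%:R - n%:R / 2) / Num.sqrt n%:R.

Lemma measurable_normalized_correct w tie :
  measurable_fun [set: T] (normalized_correct w tie).
Proof.
pose g (u : n.-tuple bool) : R :=
  ((correct_guesses tie (riffle u))%:R - n%:R / 2) / Num.sqrt n%:R.
rewrite (_ : normalized_correct w tie = g \o w) //.
apply: measurableT_comp => // _ A _; exact: measurable_tuple_bool.
Qed.

HB.instance Definition _ w tie := isMeasurableFun.Build _ _ _ _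
  (normalized_correct w tie) (measurable_normalized_correct w tie).

End random_riffle.

Definition has_pdf (R : realType) (d : measure_display) (T : measurableType d)
    (P : probability T R) (X : {RV P >-> R}) (f : R -> R) : Prop :=
  [/\ measurable_fun [set: R] f, (forall x, 0 <= f x) &
    forall A : set R, measurable A ->
      distribution P X A = (\int[lebesgue_measure]_(x in A) (f x)%:E)%E].

(* The random variables may all live on different probability spaces. *)
Definition cvg_in_distribution (R : realType)
    (d : nat -> measure_display) (T : forall n, measurableType (d n))
    (P : forall n, probability (T n) R) (X : forall n, {RV (P n) >-> R})
    (d' : measure_display) (T' : measurableType d')
    (Q : probability T' R) (Z : {RV Q >-> R}) : Prop :=
  forall x : R, {for x, continuous (cdf Z)} ->
    cdf (X n) x @[n --> \oo] --> cdf Z x.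

Definition limit_pdf {R : realType} (x : R) : R :=
  if 0 <= x then Num.sqrt (2 / pi) * (8 * x ^+ 2 * expR (- 2 * x ^+ 2)) else 0.

(* Main.v *)
(* Idea. A guess made after the first mistake is right exactly when the next card
   comes from the packet with more cards left, the tie breaking being free when
   the packets are equally long. Playing this "majority" rule from the very
   first card changes the score by at most M outside an event of probability at
   most 2 * 2 ^ - M. By induction on the length (Pascal's rule), the number of
   words of length n with p letters a and majority score c is
   'C(n, c) - 'C(n, c + 1) if c >= max(p, n - p) and 0 otherwise, whatever the
   tie breaking; summing over p gives (2 c + 1 - n)^2 'C(n + 1, c + 1) / (n + 1).
   With c = n / 2 + y sqrt n this weight, divided by the central binomial
   coefficient, tends to 4 y^2 exp(- 2 y^2) and is dominated by a multiple of
   exp(- y). Seen as step functions of y, the weights therefore have convergent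
   integrals over every measurable set, the whole line included; quotients of
   these integrals give the distribution function, so that neither Wallis' nor
   Stirling's formula is needed. *)
Require Import Defs.
From HB Require Import structures.
From mathcomp Require Import all_boot all_order all_algebra.
From mathcomp Require Import zify ring lra.
From mathcomp Require Import all_classical all_reals all_analysis.
From mathcomp Require Import measurable_realfun.

Set Implicit Arguments.
Unset Strict Implicit.
Unset Printing Implicit Defensive.

Import Order.TTheory GRing.Theory Num.Theory.
Import numFieldNormedType.Exports.

Local Open Scope classical_set_scope.
Local Open Scope ring_scope.

(** * Majority scores and ballot numbers *)

Definition majority (tau : seq bool -> bool) (u v : seq bool) : bool :=
  if (size v < (count id v).*2)%N then true
  else if ((count id v).*2 < size v)%N then false else tau u.

(** The unread suffix decides each guess; the prefix already read serves only to break ties. *)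
Definition majority_score (tau : seq bool -> bool) (w : seq bool) : nat :=
  \sum_(0 <= t < size w)
    (majority tau (take t w) (drop t w) == nth false w t).

Lemma majority_score_cons tau x w :
  majority_score tau (x :: w) =
  ((majority tau [::] (x :: w) == x) + majority_score (tau \o cons x) w)%N.
Proof. by rewrite /majority_score/= big_nat_recl//= big_mkord big_mkord. Qed.

Lemma big_tuple_boolS (F : seq bool -> nat) n :
  (\sum_(u : n.+1.-tuple bool) F u =
   \sum_(u : n.-tuple bool) (F (true :: u) + F (false :: u)))%N.
Proof.
rewrite (reindex (fun p : bool * n.-tuple bool => [tuple of p.1 :: p.2])) /=.
  rewrite big_split/= -(pair_bigA _ (fun (b : bool) (u : n.-tuple bool) =>
    F (b :: u)))/=.
  by rewrite big_bool.
exists (fun u => (thead u, [tuple of behead u])) => [[b u] _|u _] /=.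
  by congr pair; apply/val_inj.
by rewrite -tuple_eta.
Qed.

(** The two conditions force [n <= c.*2], so by [bin_decr] the truncated subtraction is an honest
    difference. *)
Definition ballot n p c : nat :=
  if (p <= c)%N && (n <= p + c)%N then ('C(n, c) - 'C(n, c.+1))%N else 0%N.

Lemma bin_decr n c : (n <= c.*2.+1)%N -> ('C(n, c.+1) <= 'C(n, c))%N.
Proof.
move=> nc; rewrite -(leq_pmul2l (ltn0Sn c)) mul_bin_left leq_mul2r.
by apply/orP; right; lia.
Qed.

(** Recursion on the first letter: a correct guess lowers the score still to be reached by one. A
    tie is played here as a guess of b. *)
Lemma ballotS n p c : ballot n.+1 p.+1 c.+1 =
  if (n.+1 < p.+1.*2)%N then (ballot n p c + ballot n p.+1 c.+1)%N
  else (ballot n p c.+1 + ballot n p.+1 c)%N.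
Proof.
rewrite /ballot !binS.
have h1 := @bin_decr n c; have h2 := @bin_decr n c.+1.
case: ltnP => np; do !case: ifP => ? //; try lia.
(* Here one summand lies outside its support, but the difference it misses,
   ['C(n, c) - 'C(n, c.+1)], is zero by symmetry of the row. *)
all: have E : n = c.*2.+1 by lia.
all: have : 'C(n, c.+1) = 'C(n, c) by rewrite -bin_sub; [congr ('C(_,_))|]; lia.
all: lia.
Qed.

Lemma sum_majority_score n p c tau :
  (\sum_(u : n.-tuple bool)
     ((count id u == p) && (majority_score tau u == c)) = ballot n p c)%N.
Proof.
elim: n p c tau => [|n IH] p c tau.
  rewrite (eq_bigr (fun=> ((0 == p) && (0 == c))%N : nat)); last first.
    by move=> u _; rewrite tuple0/= /majority_score big_nil.
  rewrite big_const card_tuple/= addn0 /ballot.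
  by case: p c => [|p] [|c] //=; case: ifP.
(* The first guess, common to all words with p letters a. *)
pose g := if (n.+1 < p.*2)%N then true else
  if (p.*2 < n.+1)%N then false else tau [::].
rewrite (big_tuple_boolS (fun u => ((count id u == p) &&
  (majority_score tau u == c) : nat))) /=.
rewrite (eq_bigr (fun u : n.-tuple bool =>
  ((count id u).+1 == p) && (g + majority_score (tau \o cons true) u == c) +
  (count id u == p) && (~~ g + majority_score (tau \o cons false) u == c)))%N;
  last first.
  move=> u _; rewrite !majority_score_cons /majority/= size_tuple.
  congr (nat_of_bool _ + nat_of_bool _)%N.
    by rewrite add1n; case: eqP => //= ->; rewrite -/g eqb_id.
  by rewrite add0n; case: eqP => //= ->; rewrite -/g eqbF_neg.
rewrite big_split/=.
have split_c (b : bool) p' tau' :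
    (\sum_(u : n.-tuple bool)
       ((count id u == p') && (b + majority_score tau' u == c)) =
     if b then if c is c'.+1 then ballot n p' c' else 0 else ballot n p' c)%N.
  case: b => /=; last exact: IH.
  case: c => [|c]; first by rewrite big1// => u _; rewrite andbF.
  by rewrite -(IH p' c tau').
rewrite split_c.
case: p @g split_c => [|p] g split_c.
  rewrite big1// add0n /g/= /ballot; case: c {split_c} => [|c]//=.
  rewrite !add0n ltnS; case: ifP => // nc.
  by rewrite !binS (@bin_small n c.+1) ?(@bin_small n c.+2); lia.
under eq_bigr do rewrite eqSS.
rewrite split_c; case: c {split_c} => [|c].
  rewrite [RHS]/ballot /= /g; case: ltnP => // pn.
  have -> : ballot n p 0 = 0%N by rewrite /ballot; case: ifP => //; lia.
  by case: ifP.
rewrite ballotS /g; case: ltnP => // pn; case: ltnP => [//|np].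
(* A tie on the first letter. Both guesses give the same count: n = 2p + 1, and exchanging a and b
   turns p letters a into p + 1. *)
have E : n.+1 = p.+1.*2 by lia.
case: (tau [::]) => //=.
rewrite /ballot.
have h1 := @bin_decr n c; have h2 := @bin_decr n c.+1.
do !case: ifP => ? //; try lia.
all: have E' : n = c.*2.+1 by lia.
all: have : 'C(n, c.+1) = 'C(n, c) by rewrite -bin_sub; [congr ('C(_,_))|]; lia.
all: lia.
Qed.

(** The nonzero terms all have the same value, and they are those with n - c <= p <= c, which leaves
    2c + 1 - n choices when c <= n. *)
Lemma sum_ballot n c :
  (\sum_(p < n.+1) ballot n p c = (c.*2.+1 - n) * ('C(n, c) - 'C(n, c.+1)))%N.
Proof.
have [nc|cn] := ltnP n c.
  rewrite [in RHS]bin_small// [in RHS]bin_small//; last by lia.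
  rewrite muln0 big1// => p _.
  rewrite /ballot bin_small// bin_small//; last by lia.
  by case: ifP.
rewrite /ballot -big_mkcond/= big_const iter_addn addn0 mulnC; congr muln.
rewrite -sum1_card -(big_mkord (fun p => (p <= c) && (n <= p + c))%N (fun=> 1%N)) /=.
rewrite (@big_cat_nat _ _ _ c.+1)//= [X in (_ + X)%N]big1_seq; last first.
  by move=> i /andP[/andP[? _]]; rewrite mem_index_iota; lia.
rewrite addn0.
have [cn2|nc2] := ltnP c.*2 n.
  rewrite big1_seq; first by rewrite (_ : c.*2.+1 - n = 0)%N//; lia.
  by move=> i /andP[/andP[? ?]]; rewrite mem_index_iota; lia.
rewrite (@big_cat_nat _ _ _ (n - c))//=; last by lia.
rewrite [X in (X + _)%N]big1_seq ?add0n; last first.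
  by move=> i /andP[/andP[? ?]]; rewrite mem_index_iota; lia.
rewrite big_nat_cond (eq_bigl (fun i => (n - c <= i < c.+1)%N)); last first.
  by move=> i; lia.
rewrite -big_nat sum_nat_const_nat muln1; lia.
Qed.

(* Up to the factor 2 ^ n, this is the law of a symmetric binomial variable
   with n + 1 trials, biased by the square of its centered value. *)
Lemma sum_majority_score_sqr n c (tau : nat -> seq bool -> bool) :
  (n.+1 * \sum_(u : n.-tuple bool) (majority_score (tau (count id u)) u == c) =
   (c.*2.+1 - n) ^ 2 * 'C(n.+1, c.+1))%N.
Proof.
(* Sorting the words by their number p of letters a makes the tie rule [tau p] constant on each
   class. *)
have -> : (\sum_(u : n.-tuple bool) (majority_score (tau (count id u)) u == c)
   = \sum_(p < n.+1) ballot n p c)%N.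
  under [RHS]eq_bigr => p _ do rewrite -(sum_majority_score n p c (tau p)).
  rewrite exchange_big/=; apply: eq_bigr => u _.
  have un : (count id u < n.+1)%N.
    by rewrite ltnS -[leqRHS](size_tuple u) count_size.
  rewrite (bigD1 (Ordinal un))//= eqxx/= big1 ?addn0// => p pu.
  case: eqP => //= up; case/eqP: pu; exact/val_inj.
rewrite sum_ballot.
have [cn|nc] := leqP c.*2.+1 n.
  by rewrite (_ : c.*2.+1 - n = 0)%N ?muln0//; lia.
have [cn|cn] := ltnP n c.
  by rewrite !bin_small ?muln0//; lia.
rewrite mulnCA expnS expn1 -mulnA; congr muln.
(* Both products are multiples of ['C(n.+1, c.+1)], with factors c + 1 and n - c, whose difference
   is the second factor 2c + 1 - n. *)
rewrite mulnBr.
rewrite (mul_bin_diag n.+1 c) (mul_bin_down n.+1 c.+1) -mulnBl.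
congr muln; lia.
Qed.

(** * The guessing game compared with the majority rule *)

Lemma sum_all_take n M : (M <= n)%N ->
  (\sum_(u : n.-tuple bool) all id (take M u) = 2 ^ (n - M))%N.
Proof.
elim: n M => [|n IH] [|M] // Mn.
- under eq_bigr do rewrite take0/=.
  by rewrite sum1_card card_tuple.
- under eq_bigr do rewrite take0/=.
  by rewrite sum1_card card_tuple card_bool.
- rewrite (big_tuple_boolS (fun u => (all id (take M.+1 u) : nat)))/=.
  by under eq_bigr do rewrite addn0; rewrite IH.
Qed.

Lemma sum_hasN_drop n M : (M <= n)%N ->
  (\sum_(u : n.-tuple bool) ~~ has id (drop M u) = 2 ^ M)%N.
Proof.
elim: n M => [|n IH] [|M] // Mn.
- by rewrite (eq_bigr (fun=> 1%N)) ?sum1_card ?card_tuple// => u _; rewrite tuple0.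
- rewrite (big_tuple_boolS (fun u => (~~ has id (drop 0 u) : nat)))/=.
  by rewrite -[RHS](IH 0%N)//; apply: eq_bigr => u _; rewrite drop0.
- rewrite (big_tuple_boolS (fun u => (~~ has id (drop M.+1 u) : nat)))/=.
  by rewrite big_split/= IH// addnn expnS mul2n.
Qed.

Lemma size_fill i j w : size (fill i j w) = size w.
Proof. by elim: w i j => //= -[] w IH i j /=; rewrite IH. Qed.

Lemma fill_cat i j u v :
  fill i j (u ++ v) =
  fill i j u ++ fill (i + count id u) (j + count negb u) v.
Proof.
elim: u i j => [|[] u IH] i j /=; first by rewrite !addn0.
  by rewrite IH add0n add1n addnS addSn.
by rewrite IH add0n add1n addnS addSn.
Qed.

Lemma mem_fill i j w x : (x \in fill i j w) =
  ((i <= x < i + count id w) || (j <= x < j + count negb w))%N.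
Proof. by elim: w i j => [|[] w IH] i j /=; rewrite ?in_cons ?IH ?in_nil; lia. Qed.

Lemma fill_nseq_true i j L : fill i j (nseq L true) = iota i L.
Proof. by elim: L i => //= L IH i; rewrite IH. Qed.

(** Each packet is drawn in increasing order, so its missing labels form a final segment of an
    interval. This computes [low] and [high] in [guess]. *)
Lemma filter_iota_notin (h : seq nat) i a b :
  (forall x, i <= x < i + a -> x \in h)%N ->
  (forall x, i + a <= x < i + a + b -> x \notin h)%N ->
  [seq x <- iota i (a + b) | x \notin h] = iota (i + a) b.
Proof.
move=> ha hb; rewrite iotaD filter_cat.
rewrite (eq_in_filter (a2 := pred0)); last first.
  by move=> x; rewrite mem_iota => /ha ->.
rewrite filter_pred0 cat0s (eq_in_filter (a2 := predT)) ?filter_predT//.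
by move=> x; rewrite mem_iota => /hb ->.
Qed.

(** After the mistake the packets [low] and [high] have as many cards left as v has letters a and b,
    so comparing their sizes is the majority rule on v. The hypothesis on L makes the first b a
    genuine mistake. *)
Lemma guess_after_mistake n tie L u v :
  let w := nseq L true ++ false :: u ++ v in
  let pre := nseq L true ++ false :: u in
  (size w = n) -> (L < count id w)%N ->
  forall x v', v = x :: v' ->
  (guess n tie (take (size pre) (riffle w)) == nth 0%N (riffle w) (size pre)) =
  (majority (fun h => tie (fill 1 (count id w).+1 h)) pre v == x).
Proof.
move=> w pre wn Lw x v' vE; set k := count id w in Lw *.
have wE : w = pre ++ v by rewrite /w /pre -catA.
have riffleE : riffle w = fill 1 k.+1 pre ++
    fill (1 + count id pre) (k.+1 + count negb pre) v.
  by rewrite -fill_cat -wE.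
have cpre : count id pre = (L + count id u)%N.
  by rewrite /pre count_cat/= count_nseq mul1n add0n.
have nv : size v = (count id v + count negb v)%N by rewrite count_predC.
have npre : size pre = (count id pre + count negb pre)%N by rewrite count_predC.
have cnpre : (0 < count negb pre)%N.
  by rewrite /pre count_cat/= addnCA.
have kE : k = (count id pre + count id v)%N by rewrite /k wE count_cat.
have wn' : n = (size pre + size v)%N by rewrite -wn wE size_cat.
rewrite riffleE take_size_cat ?size_fill// nth_cat size_fill ltnn subnn.
set h := fill 1 k.+1 pre.
have hE : h = iota 1 L ++ k.+1 :: fill L.+1 k.+2 u.
  by rewrite /h /pre fill_cat fill_nseq_true !count_nseq/= mul1n mul0n addn0 add1n.
have hL : nth 0%N h L = k.+1 by rewrite hE nth_cat size_iota ltnn subnn.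
(* The first L cards are 1, ..., L as guessed; the next one has label k + 1, which differs from the
   guess L + 1 because L < k. *)
have findE : find (fun i => nth 0%N h i != i.+1) (iota 0 (size h)) = L.
  have -> : size h = (L + (size u).+1)%N.
    by rewrite hE size_cat size_iota/= size_fill.
  rewrite iotaD find_cat ifF/=; last first.
    apply/hasP => -[i]; rewrite mem_iota add0n => /= iL.
    by rewrite hE nth_cat size_iota iL nth_iota// add1n eqxx.
  by rewrite hL size_iota add0n ifT ?addn0//; lia.
have sh : size h = size pre by rewrite size_fill.
have Lpre : (L < size pre)%N by rewrite /pre size_cat size_nseq/=; lia.
rewrite /guess findE sh (ltn_eqF Lpre) hL.
have -> : (k.+1 - L.+1 = count id u + count id v)%N by lia.
rewrite filter_iota_notin; first last.
- by move=> y ?; rewrite mem_fill; lia.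
- by move=> y ?; rewrite mem_fill; lia.
(* The predecessor appears because the card k + 1, drawn at the mistake, is excluded from [high]. *)
have -> : (n - k.+1 = (count negb pre).-1 + count negb v)%N by lia.
rewrite filter_iota_notin; first last.
- by move=> y ?; rewrite mem_fill; lia.
- by move=> y ?; rewrite mem_fill; lia.
rewrite !size_iota /majority nv -addnn !ltn_add2l -/h.
have headE i m : (0 < m)%N -> head 0%N (iota i m) = i by case: m.
have -> i j : nth 0%N (fill i j v) 0 = if x then i else j.
  by rewrite vE; case: (x).
(* The packet of the next card is nonempty, so the default value of [head] is never the guess: an
   empty packet is strictly shorter than the other one. *)
have : (0 < if x then count id v else count negb v)%N by rewrite vE; case: (x).
case: x {vE} => cv; rewrite ?eqb_id ?eqbF_neg.
  case: ltnP => [?|c1]; first by rewrite headE; lia.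
  case: ltnP => [c2|c2]; first by rewrite headE; lia.
  by case: tie; rewrite headE; lia.
case: ltnP => [?|c1]; first by rewrite headE; lia.
case: ltnP => [c2|c2]; first by rewrite headE; lia.
by case: tie; rewrite headE; lia.
Qed.

(** The two games agree term by term from index L + 1 on, and the first L + 1 terms of either sum
    are at most 1. *)
Lemma correct_guesses_majority_score tie L w' :
  let w := nseq L true ++ false :: w' in
  let score := majority_score (fun h => tie (fill 1 (count id w).+1 h)) w in
  (L < count id w)%N ->
  (correct_guesses tie (riffle w) <= score + L.+1 /\
   score <= correct_guesses tie (riffle w) + L.+1)%N.
Proof.
move=> w; set k := count id w => score Lw.
have sw : size w = (L + (size w').+1)%N by rewrite size_cat size_nseq.
pose F t : nat := guess (size w) tie (take t (riffle w)) == nth 0%N (riffle w) t.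
pose G t : nat :=
  majority (fun h => tie (fill 1 k.+1 h)) (take t w) (drop t w) == nth false w t.
have -> : correct_guesses tie (riffle w) = (\sum_(0 <= t < size w) F t)%N.
  by rewrite /correct_guesses size_fill.
have -> : score = (\sum_(0 <= t < size w) G t)%N by [].
have FG : (\sum_(L.+1 <= t < size w) F t = \sum_(L.+1 <= t < size w) G t)%N.
  apply: eq_big_nat => t /andP[Lt tw]; congr nat_of_bool.
  pose u := take (t - L.+1) w'; pose v := drop (t - L.+1) w'.
  have su : size u = (t - L.+1)%N by rewrite size_takel//; lia.
  pose pre := nseq L true ++ false :: u.
  have wE : w = pre ++ v by rewrite /pre /u /v -catA/= cat_take_drop.
  have sp : size pre = t by rewrite size_cat size_nseq/= su; lia.
  have v0 : (0 < size v)%N by rewrite size_drop; lia.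
  have vE : v = head false v :: behead v by case: v {wE} v0.
  have wE' : w = nseq L true ++ false :: u ++ v by rewrite wE /pre -catA.
  have := @guess_after_mistake (size w) tie L u v.
  cbv zeta; rewrite -wE' -/k -/pre sp => /(_ erefl Lw _ _ vE).
  rewrite /F => ->; rewrite /G.
  by rewrite wE take_size_cat// drop_size_cat// nth_cat sp ltnn subnn nth0.
have bnd (H : nat -> nat) : (forall t, H t <= 1)%N ->
    (\sum_(0 <= t < L.+1) H t <= L.+1)%N.
  move=> H1; rewrite -[leqRHS]muln1 -[X in (_ <= X * _)%N]subn0 -sum_nat_const_nat.
  by apply: leq_sum => t _; exact: H1.
have Lsw : (L.+1 <= size w)%N by lia.
rewrite !(@big_cat_nat _ _ _ L.+1 0 (size w))//= FG.
have := bnd F (fun=> leq_b1 _); have := bnd G (fun=> leq_b1 _).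
by split; lia.
Qed.

(** Let L be the number of leading a's. A letter b among the first M gives L < M, and a letter a
    after them gives L < [count id w], so that the first mistake occurs at index L. *)
Lemma correct_guesses_close tie M w : (M <= size w)%N ->
  ~~ all id (take M w) -> has id (drop M w) ->
  let score := majority_score (fun h => tie (fill 1 (count id w).+1 h)) w in
  (correct_guesses tie (riffle w) <= score + M /\
   score <= correct_guesses tie (riffle w) + M)%N.
Proof.
move=> Mw nallM hasM.
pose L := find negb w.
have hasw : has negb w.
  by rewrite -has_predC in nallM; rewrite -(cat_take_drop M w) has_cat nallM.
have Lw : (L < size w)%N by rewrite -has_find.
have LM : (L < M)%N.
  rewrite ltnNge; apply: contra nallM => ML; apply/(all_nthP false) => i.
  rewrite size_takel// => iM; rewrite nth_take//.
  by have /negbFE := @before_find _ false negb w i (leq_trans iM ML).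
have takeL : take L w = nseq L true.
  apply: (@eq_from_nth _ false); rewrite size_takel ?size_nseq//; try exact: ltnW.
  move=> i iL; rewrite nth_take// nth_nseq iL.
  by have /negbFE := @before_find _ false negb w i iL.
have wE : w = nseq L true ++ false :: drop L.+1 w.
  rewrite -takeL -{1}(cat_take_drop L w) (drop_nth false Lw); congr (_ ++ _ :: _).
  by have := nth_find false hasw; rewrite -/L => /negbTE.
have Lc : (L < count id w)%N.
  rewrite wE count_cat/= count_nseq mul1n add0n -ltn_subLR// subnn -has_count.
  have -> : drop L.+1 w = take (M - L.+1) (drop L.+1 w) ++ drop M w.
    by rewrite -{1}(cat_take_drop (M - L.+1) (drop L.+1 w)) drop_drop subnK.
  by rewrite has_cat hasM orbT.
have := @correct_guesses_majority_score tie L (drop L.+1 w).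
rewrite -wE => /(_ Lc) /=; lia.
Qed.

(** * Bounds for ratios of binomial coefficients *)

Section binomial_ratio.
Variable R : realType.
Implicit Types n i : nat.

(** The index i is the excess of a majority score over its least possible value [uphalf n]. *)
Definition bin_ratio n i : R :=
  'C(n.+1, (uphalf n + i).+1)%:R / 'C(n.+1, (uphalf n).+1)%:R.

Lemma bin_ratio_ge0 n i : 0 <= bin_ratio n i.
Proof. by rewrite divr_ge0. Qed.

Lemma bin_uphalf_gt0 n : (0 < 'C(n.+1, (uphalf n).+1))%N.
Proof. by rewrite bin_gt0; lia. Qed.

Lemma bin_ratio0 n : bin_ratio n 0 = 1.
Proof. by rewrite /bin_ratio addn0 divff// pnatr_eq0 -lt0n bin_uphalf_gt0. Qed.

Lemma bin_ratio_small n i : (n./2 < i)%N -> bin_ratio n i = 0.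
Proof. by move=> ni; rewrite /bin_ratio bin_small ?mul0r//; lia. Qed.

Lemma bin_ratioS n i : bin_ratio n i.+1 =
  bin_ratio n i * ((n./2 - i)%N%:R / (uphalf n + i).+2%:R).
Proof.
rewrite /bin_ratio addnS mulrAC; congr (_ / _).
apply: (@mulfI _ (uphalf n + i).+2%:R); first by rewrite pnatr_eq0.
rewrite [RHS]mulrC mulrA divfK ?pnatr_eq0// -!natrM mul_bin_left mulnC.
by congr ((_ * _)%N%:R); lia.
Qed.

(** Each factor of [bin_ratioS] is at most 1 - 2(j + 1)/D, hence at most exp(- 2(j + 1)/D); the
    numbers 2(j + 1) for j < i add up to i(i + 1). *)
Lemma bin_ratio_le n i (D : R) : (uphalf n + i).+1%:R <= D ->
  bin_ratio n i <= expR (- (i%:R * i.+1%:R / D)).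
Proof.
have D0 : (uphalf n + i).+1%:R <= D -> 0 < D by apply: lt_le_trans; rewrite ltr0n.
elim: i D0 => [|i IH] D0 iD; first by rewrite bin_ratio0 !mul0r oppr0 expR0.
have {}D0 := D0 iD.
have iD' : (uphalf n + i).+2%:R <= D by rewrite (le_trans _ iD)// ler_nat; lia.
have -> : - (i.+1%:R * i.+2%:R / D) =
    - (i%:R * i.+1%:R / D) + - (2 * i.+1%:R / D).
  by rewrite -opprD -mulrDl; congr (- (_ / _)); rewrite -!natr1; ring.
rewrite bin_ratioS expRD ler_pM ?bin_ratio_ge0 ?divr_ge0//.
  by apply: IH => //; rewrite (le_trans _ iD')// ler_nat; lia.
have [ni|ni] := leqP n./2 i.
  by rewrite (eqP (_ : n./2 - i == 0)%N)// mul0r expR_ge0.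
rewrite (le_trans _ (expR_ge1Dx _))// lerBrDr.
apply: (@le_trans _ _ ((n./2 - i)%N%:R / (uphalf n + i).+2%:R +
   2 * i.+1%:R / (uphalf n + i).+2%:R)).
  by rewrite lerD2l ler_wpM2l ?mulr_ge0// lef_pV2 ?posrE.
rewrite -mulrDl ler_pdivrMr// mul1r -natrM -natrD ler_nat; lia.
Qed.

(** The inverse of each factor is at most 1 + (2j + 3)/E, hence at most exp((2j + 3)/E); the numbers
    2j + 3 for j < i add up to i(i + 2). *)
Lemma bin_ratio_ge n i (E : R) : 0 < E -> E <= (n./2.+1 - i)%N%:R ->
  expR (- (i%:R * i.+2%:R / E)) <= bin_ratio n i.
Proof.
move=> E0; elim: i => [|i IH] iE; first by rewrite bin_ratio0 !mul0r oppr0 expR0.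
have iE' : E <= (n./2 - i)%N%:R by rewrite (le_trans iE)// ler_nat; lia.
have ni : (i < n./2)%N by rewrite -subn_gt0 -(ltr0n R) (lt_le_trans E0).
have -> : - (i.+1%:R * i.+3%:R / E) =
    - (i%:R * i.+2%:R / E) + - (i.*2.+3%:R / E).
  rewrite -opprD -mulrDl -natrM -natrM -natrD.
  by congr (- (_%:R / _)); lia.
rewrite bin_ratioS expRD ler_pM ?expR_ge0//.
  by apply: IH; rewrite (le_trans iE')// ler_nat; lia.
rewrite expRN -[leRHS]invf_div.
rewrite lef_pV2 ?posrE ?expR_gt0 ?divr_gt0 ?ltr0n ?subn_gt0//.
apply: (le_trans _ (expR_ge1Dx _)).
apply: (@le_trans _ _ (1 + i.*2.+3%:R / (n./2 - i)%N%:R)).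
  rewrite -[X in X + _](@divff _ (n./2 - i)%N%:R); last by rewrite pnatr_eq0; lia.
  rewrite -mulrDl ler_wpM2r ?invr_ge0// -natrD ler_nat; lia.
by rewrite lerD2l ler_wpM2l// lef_pV2 ?posrE// ltr0n subn_gt0.
Qed.

(** The squared number is 2c + 1 - n at c = [uphalf n + i], so this is the number of words of score
    c up to a factor independent of i. *)
Definition radial_weight n i : R :=
  ((i.*2.+1 + odd n) ^ 2)%N%:R / n%:R * bin_ratio n i.

Lemma radial_weight_ge0 n i : 0 <= radial_weight n i.
Proof. by rewrite mulr_ge0 ?divr_ge0 ?bin_ratio_ge0. Qed.

Lemma radial_weight_le n i : (0 < n)%N ->
  radial_weight n i <= 8 * expR (4 - i%:R / Num.sqrt n%:R).
Proof.
move=> n0; have [ni|ni] := ltnP n./2 i.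
  by rewrite /radial_weight bin_ratio_small// mulr0 mulr_ge0 ?expR_ge0.
have nR0 : 0 < n%:R :> R by rewrite ltr0n.
set s := Num.sqrt _; have s0 : 0 < s by rewrite sqrtr_gt0.
have s2 : s ^+ 2 = n%:R by rewrite sqr_sqrtr// ltW.
have s1 : 1 <= s by rewrite -(@ler_pXn2r _ 2) ?nnegrE ?(ltW s0)// s2 expr1n ler1n.
set z := i%:R / s; have z0 : 0 <= z by rewrite divr_ge0// ltW.
have iE : i%:R = z * s by rewrite /z divfK ?gt_eqF.
have hw : ((i.*2.+1 + odd n) ^ 2)%N%:R / n%:R <= 4 * (z + 1) ^+ 2.
  rewrite ler_pdivrMr//; apply: (@le_trans _ _ (4 * (i%:R + 1) ^+ 2)).
    by rewrite natr1 -natrX -natrM ler_nat; nia.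
  rewrite -mulrA ler_wpM2l// -s2 -exprMn ler_pXn2r ?nnegrE ?addr_ge0//; last first.
    by rewrite mulr_ge0 ?addr_ge0// ltW.
  by rewrite iE mulrDl mul1r lerD2l.
(* The bound D = 3n is admissible because i <= n / 2. *)
have hr : bin_ratio n i <= expR (- (z ^+ 2 / 3)).
  apply: (le_trans (@bin_ratio_le n i (3 * n%:R) _)).
    by rewrite -natrM ler_nat; lia.
  have -> : z ^+ 2 / 3 = i%:R * i%:R / (3 * n%:R).
    by rewrite iE -s2; field; rewrite gt_eqF.
  by rewrite ler_expR lerN2 ler_wpM2r ?invr_ge0 ?mulr_ge0// ler_wpM2l// ler_nat.
have he : 4 * (z + 1) ^+ 2 <= 8 * expR (z + 1).
  rewrite (_ : 8 = 4 * 2); last by ring.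
  rewrite -mulrA ler_wpM2l//.
  have := @expR_ge1Dxn R (z + 1) 1; rewrite addr_ge0// => /(_ isT).
  by rewrite (_ : 2`! = 2)%N// => h; lra.
apply: (@le_trans _ _ (8 * expR (z + 1) * expR (- (z ^+ 2 / 3)))).
  by rewrite ler_pM ?bin_ratio_ge0 ?divr_ge0// (le_trans hw).
rewrite -mulrA -expRD ler_wpM2l// ler_expR.
(* The claim z + 1 - z^2 / 3 <= 4 - z is (z - 3)^2 >= 0. *)
have := sqr_ge0 (z - 3); lra.
Qed.

End binomial_ratio.

(** * Pointwise limit of the rescaled weights *)

Section radial_limit.
Variable R : realType.
Implicit Types n i : nat.

Lemma cvg_sqrt_natr : Num.sqrt (n%:R : R) @[n --> \oo] --> +oo.
Proof.
apply/cvgryPge => A; near=> n.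
have nA : `|A| ^+ 2 <= n%:R by near: n; exact: nbhs_infty_ger.
rewrite (le_trans (ler_norm A))// -(@ler_pXn2r _ 2) ?nnegrE ?sqrtr_ge0//.
by rewrite sqr_sqrtr.
Unshelve. all: by end_near. Qed.

Lemma cvg_inv_sqrt_natr : (Num.sqrt (n%:R : R))^-1 @[n --> \oo] --> 0.
Proof.
apply/gtr0_cvgV0; last exact: cvg_sqrt_natr.
by near=> n; rewrite sqrtr_gt0 ltr0n; near: n; exact: nbhs_infty_gt.
Unshelve. all: by end_near. Qed.

Lemma cvg_truncn_sqrt (y : R) : 0 <= y ->
  (Num.truncn (y * Num.sqrt n%:R))%:R / Num.sqrt n%:R @[n --> \oo] --> y.
Proof.
move=> y0.
apply: (@squeeze_cvgr _ _ _ _ (fun n => y - (Num.sqrt n%:R)^-1) (fun=> y)).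
- near=> n.
  have s0 : 0 < Num.sqrt (n%:R : R).
    by rewrite sqrtr_gt0 ltr0n; near: n; exact: nbhs_infty_gt.
  have /truncn_itv/andP[h1 h2] : 0 <= y * Num.sqrt n%:R.
    by rewrite mulr_ge0// ltW.
  rewrite ler_pdivrMr// h1 andbT ler_pdivlMr// mulrBl mulVf ?gt_eqF//.
  by rewrite lerBlDr natr1 ltW.
- rewrite -[X in _ --> X]subr0; apply: cvgB; first exact: cvg_cst.
  exact: cvg_inv_sqrt_natr.
- exact: cvg_cst.
Unshelve. all: by end_near. Qed.

Lemma cvg_half_natr (f : nat -> nat) :
  (forall n, n <= (f n).*2.+1 /\ (f n).*2 <= n.+1)%N ->
  (f n)%:R / n%:R @[n --> \oo] --> (1 / 2 : R).
Proof.
move=> fn.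
have inv_n : (Num.sqrt (n%:R : R))^-1 ^+ 2 @[n --> \oo] --> (0 : R).
  rewrite -[X in _ --> X](expr0n _ 2).
  under eq_fun do rewrite expr2.
  by rewrite expr2; apply: cvgM; exact: cvg_inv_sqrt_natr.
apply: (@squeeze_cvgr _ _ _ _ (fun n => 1 / 2 - (Num.sqrt (n%:R : R))^-1 ^+ 2)
  (fun n => 1 / 2 + (Num.sqrt (n%:R : R))^-1 ^+ 2)).
- near=> n.
  have n0 : 0 < n%:R :> R by rewrite ltr0n; near: n; exact: nbhs_infty_gt.
  rewrite exprVn sqr_sqrtr ?(ltW n0)// ler_pdivlMr// ler_pdivrMr//.
  rewrite mulrBl mulrDl mulVf ?gt_eqF//.
  have [h1 h2] := fn n.
  have {}h1 : n%:R <= (f n)%:R * 2 + 1 :> R.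
    by rewrite -natrM natr1 ler_nat muln2.
  have {}h2 : (f n)%:R * 2 <= n%:R + 1 :> R.
    by rewrite -natrM natr1 ler_nat muln2.
  by apply/andP; split; lra.
- rewrite -[X in _ --> X]subr0; apply: cvgB => //; exact: cvg_cst.
- rewrite -[X in _ --> X]addr0; apply: cvgD => //; exact: cvg_cst.
Unshelve. all: by end_near. Qed.

(** Squeeze between [bin_ratio_ge] and [bin_ratio_le] with their best constants. Dividing numerator
    and denominator of the exponents by n leaves the convergent sequences r, v, a and b, and both
    exponents tend to - y^2 / (1 / 2). *)
Lemma cvg_radial_weight (y : R) : 0 <= y ->
  radial_weight R n (Num.truncn (y * Num.sqrt n%:R)) @[n --> \oo] -->
  4 * y ^+ 2 * expR (- (2 * y ^+ 2)).
Proof.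
move=> y0.
pose s n : R := Num.sqrt n%:R; pose v n : R := (s n)^-1.
pose I n := Num.truncn (y * s n).
pose r n : R := (I n)%:R / s n.
pose a n : R := n./2%:R / n%:R; pose b n : R := (uphalf n)%:R / n%:R.
have cv : v n @[n --> \oo] --> (0 : R) := cvg_inv_sqrt_natr.
have cr : r n @[n --> \oo] --> y := cvg_truncn_sqrt y0.
have ca : a n @[n --> \oo] --> (1 / 2 : R) by apply: cvg_half_natr => n; split; lia.
have cb : b n @[n --> \oo] --> (1 / 2 : R) by apply: cvg_half_natr => n; split; lia.
have ce : (odd n).+1%:R * v n @[n --> \oo] --> (0 : R).
  apply: (@squeeze_cvgr _ _ _ _ (fun=> 0) (fun n => 2 * v n)).
  - near=> n; rewrite mulr_ge0 ?invr_ge0 ?sqrtr_ge0//=.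
    by rewrite ler_wpM2r ?invr_ge0 ?sqrtr_ge0// ler_nat; case: odd.
  - exact: cvg_cst.
  - by rewrite -[X in _ --> X](mulr0 2); apply: cvgM => //; exact: cvg_cst.
have cexp (f : nat -> R) l : f n @[n --> \oo] --> l ->
    expR (- f n) @[n --> \oo] --> expR (- l).
  move=> fl; apply: (@continuous_cvg _ _ _ _ _ _ _).
    exact: continuous_expR.
  exact: cvgN.
have csq : (2 * r n + (odd n).+1%:R * v n) ^+ 2 @[n --> \oo] --> (2 * y + 0) ^+ 2.
  have c2 : 2 * r n + (odd n).+1%:R * v n @[n --> \oo] --> 2 * y + 0.
    by apply: cvgD => //; apply: cvgM => //; exact: cvg_cst.
  by rewrite expr2; under eq_fun do rewrite expr2; exact: cvgM.
apply: (@squeeze_cvgr _ _ _ _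
  (fun n => (2 * r n + (odd n).+1%:R * v n) ^+ 2 *
    expR (- (r n * (r n + 2 * v n) / (a n + v n * v n - r n * v n))))
  (fun n => (2 * r n + (odd n).+1%:R * v n) ^+ 2 *
    expR (- (r n * (r n + v n) / (b n + r n * v n + v n * v n))))).
- near=> n.
  (* This makes [I n] at most n / 2, so that the denominator in the lower bound is positive. *)
  have sb : 2 * y + 2 <= s n.
    by near: n; have /cvgryPge := cvg_sqrt_natr; apply.
  have s0 : 0 < s n by rewrite (lt_le_trans _ sb)// ltr_wpDl// mulr_ge0.
  have sN : s n != 0 by rewrite gt_eqF.
  have s2 : n%:R = s n ^+ 2 by rewrite sqr_sqrtr.
  have /truncn_itv/andP[I1 _] : 0 <= y * s n by rewrite mulr_ge0// ltW.
  have In : (I n <= n./2)%N.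
    rewrite -(ler_nat R).
    have : n%:R <= n./2%:R * 2 + 1 :> R.
      by rewrite -natrM natr1 ler_nat; lia.
    rewrite s2; have : (2 * y + 2) * s n <= s n ^+ 2 by rewrite expr2 ler_pM2r.
    have : 2 <= s n by rewrite (le_trans _ sb)// lerDr mulr_ge0.
    rewrite /I; lra.
  have wE : (((I n).*2.+1 + odd n) ^ 2)%N%:R / n%:R =
      (2 * r n + (odd n).+1%:R * v n) ^+ 2 :> R.
    rewrite natrX s2 /r /v addSn -addnS natrD -muln2 natrM.
    by field.
  rewrite /radial_weight -/(s n) -/(I n) wE.
  apply/andP; split; rewrite ler_wpM2l ?sqr_ge0//.
    apply: (le_trans _
      (@bin_ratio_ge R n (I n) (n./2.+1 - I n)%N%:R _ _)) => //; last first.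
      by rewrite ltr0n; lia.
    rewrite le_eqVlt; apply/orP; left; apply/eqP; congr (expR (- _)).
    rewrite natrB; last by lia.
    rewrite /a /r /v s2 -!natr1; field.
    rewrite sN andbT gt_eqF// subr_gt0 natr1 ltr_nat; lia.
  apply: (le_trans (@bin_ratio_le R n (I n) (uphalf n + I n).+1%:R _)) => //.
  rewrite le_eqVlt; apply/orP; left; apply/eqP; congr (expR (- _)).
  rewrite /b /r /v s2 -!natr1 natrD; field.
  by rewrite sN -natrD natr1 pnatr_eq0.
- rewrite (_ : 4 * _ * _ = (2 * y + 0) ^+ 2 *
      expR (- (y * (y + 2 * 0) / (1 / 2 + 0 * 0 - y * 0)))); last first.
    by congr (_ * expR (- _)); field.
  apply: cvgM; first exact: csq.
  apply: cexp; apply: cvgM.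
    apply: cvgM => //; apply: cvgD => //; apply: cvgM => //; exact: cvg_cst.
  apply: cvgV; first by rewrite !mulr0 subr0 addr0.
  apply: cvgB; last exact: cvgM.
  by apply: cvgD => //; exact: cvgM.
- rewrite (_ : 4 * _ * _ = (2 * y + 0) ^+ 2 *
      expR (- (y * (y + 0) / (1 / 2 + y * 0 + 0 * 0)))); last first.
    by congr (_ * expR (- _)); field.
  apply: cvgM; first exact: csq.
  apply: cexp; apply: cvgM.
    by apply: cvgM => //; exact: cvgD.
  apply: cvgV; first by rewrite !mulr0 !addr0.
  apply: cvgD; last exact: cvgM.
  by apply: cvgD => //; exact: cvgM.
Unshelve. all: by end_near. Qed.

End radial_limit.

(** * Step functions and dominated convergence *)

Section radial_step.
Variable R : realType.
Local Notation mu := (@lebesgue_measure R).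
Implicit Types n i : nat.

(** The factor that turns 4 y^2 exp(- 2 y^2) into [limit_pdf]; it cancels in quotients of
    integrals. *)
Definition limit_const : R := 2 * Num.sqrt (2 / pi).

Lemma limit_const_gt0 : 0 < limit_const.
Proof. by rewrite mulr_gt0// sqrtr_gt0 divr_gt0// pi_gt0. Qed.

Definition radial_step n (y : R) : R :=
  if 0 <= y then
    limit_const * radial_weight R n (Num.truncn (y * Num.sqrt n%:R))
  else 0.

Lemma radial_weight0n i : radial_weight R 0 i = 0.
Proof. by rewrite /radial_weight invr0 mulr0 mul0r. Qed.

Lemma radial_step_ge0 n y : 0 <= radial_step n y.
Proof.
rewrite /radial_step; case: ifP => // _.
by rewrite mulr_ge0 ?radial_weight_ge0// ltW// limit_const_gt0.
Qed.

Definition cell n i : set R :=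
  `[i%:R / Num.sqrt n%:R, i.+1%:R / Num.sqrt n%:R[%classic.

Lemma mem_cell n i y : (0 < n)%N ->
  (y \in cell n i) = (0 <= y) && (Num.truncn (y * Num.sqrt n%:R) == i).
Proof.
move=> n0; have s0 : 0 < Num.sqrt n%:R :> R by rewrite sqrtr_gt0 ltr0n.
rewrite mem_setE in_itv/= ler_pdivrMr// ltr_pdivlMr//.
have [y0|y0]/= := leP 0 y; first by rewrite truncn_eq// mulr_ge0// ltW.
by apply/negbTE; rewrite negb_and -ltNge (lt_le_trans _ (ler0n _ i))// pmulr_llt0.
Qed.

Lemma radial_stepE n y : radial_step n y =
  \sum_(i < n.+1) limit_const * radial_weight R n i * \1_(cell n i) y.
Proof.
case: n => [|n].
  rewrite big1 => [|i _]; last by rewrite radial_weight0n mulr0 mul0r.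
  by rewrite /radial_step radial_weight0n mulr0 if_same.
under eq_bigr do rewrite indicE mem_cell//.
rewrite /radial_step; case: ifP => y0 /=; last first.
  by rewrite big1// => i _; rewrite mulr0.
set k := Num.truncn _.
have [kn|nk] := ltnP k n.+2.
  rewrite (bigD1 (Ordinal kn))//= eqxx mulr1 big1 ?addr0// => i ik.
  case: eqP => [ki|]; last by rewrite mulr0.
  by case/eqP: ik; exact/val_inj.
(* Beyond the last cell of the sum the binomial coefficient is already zero. *)
rewrite [X in _ * X]/radial_weight bin_ratio_small; last by lia.
rewrite !mulr0 big1// => i _; case: eqP => [ki|_]; last by rewrite mulr0.
by have := ltn_ord i; lia.
Qed.

Lemma measurable_radial_step n : measurable_fun [set: R] (radial_step n).
Proof.
rewrite (_ : radial_step n = fun y =>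
  \sum_(i < n.+1) limit_const * radial_weight R n i * \1_(cell n i) y).
  apply: measurable_sum => i; apply: measurable_funM => //.
  by apply: measurable_indic; exact: measurable_itv.
by apply/funext => y; exact: radial_stepE.
Qed.

Lemma integral_radial_step n (D : set R) : measurable D ->
  (\int[mu]_(y in D) (radial_step n y)%:E =
   \sum_(i < n.+1) (limit_const * radial_weight R n i)%:E *
     mu (cell n i `&` D))%E.
Proof.
move=> mD.
have mcell i : measurable (cell n i) by exact: measurable_itv.
have w0 i : 0 <= limit_const * radial_weight R n i.
  by rewrite mulr_ge0 ?radial_weight_ge0// ltW// limit_const_gt0.
under eq_integral do rewrite radial_stepE -sumEFin.
rewrite ge0_integral_sum//=; last 2 first.
- move=> i; apply/measurable_EFinP; apply: measurable_funM => //.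
  by apply: measurable_funTS; apply: measurable_indic; exact: mcell.
- by move=> i y _; rewrite lee_fin mulr_ge0.
apply: eq_bigr => i _; under eq_integral do rewrite EFinM.
rewrite ge0_integralZl//=; last 2 first.
- apply/measurable_EFinP; apply: measurable_funTS; apply: measurable_indic.
  exact: mcell.
- by rewrite lee_fin.
congr (_ * _)%E; apply: integral_indic; [exact: mD|exact: mcell].
Qed.

(** Truncation loses at most 1 / sqrt n <= 1 in y, which raises the exponent 4 of [radial_weight_le]
    to 5. *)
Lemma radial_step_le n y :
  radial_step n y <= limit_const * (8 * expR 5) * exponential_pdf 1 y.
Proof.
have [y0|y0] := ltP y 0.
  by rewrite lt0_exponential_pdf// mulr0 /radial_step (lt_geF y0).
rewrite exponential_pdfE// mul1r mulN1r -mulrA -(mulrA 8) -expRD /radial_step ifT//.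
rewrite ler_pM2l ?limit_const_gt0//.
case: n => [|n]; first by rewrite radial_weight0n mulr_ge0 ?expR_ge0.
have s1 : 1 <= Num.sqrt n.+1%:R :> R.
  by rewrite -{1}(@sqrtr1 R); apply: ler_wsqrtr; rewrite ler1n.
have s0 := lt_le_trans ltr01 s1.
rewrite (le_trans (radial_weight_le _ _ _))// ler_wpM2l// ler_expR.
set s := Num.sqrt _ in s0 s1 *; set k := Num.truncn _.
have /truncn_itv/andP[_ yk] : 0 <= y * s by rewrite mulr_ge0// ltW.
have : y <= (k%:R + 1) / s by rewrite ler_pdivlMr// natr1 ltW.
have : s^-1 <= 1 by rewrite invf_le1.
by rewrite mulrDl mul1r; lra.
Qed.

Lemma limit_pdf_lt0 (y : R) : y < 0 -> limit_pdf y = 0.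
Proof. by move=> y0; rewrite /limit_pdf leNgt y0. Qed.

Lemma limit_pdf_ge0 (y : R) : 0 <= limit_pdf y.
Proof.
rewrite /limit_pdf; case: ifP => // y0.
by rewrite !mulr_ge0 ?sqrtr_ge0 ?expR_ge0 ?sqr_ge0.
Qed.

Lemma cvg_radial_step (y : R) : radial_step n y @[n --> \oo] --> limit_pdf y.
Proof.
rewrite /radial_step /limit_pdf; case: ifP => y0; last exact: cvg_cst.
have -> : Num.sqrt (2 / pi) * (8 * y ^+ 2 * expR (- 2 * y ^+ 2)) =
    limit_const * (4 * y ^+ 2 * expR (- (2 * y ^+ 2))).
  by rewrite mulNr /limit_const; ring.
by apply: cvgM; [exact: cvg_cst|exact: cvg_radial_weight].
Qed.

Lemma measurable_limit_pdf : measurable_fun [set: R] (@limit_pdf R).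
Proof.
apply: (measurable_fun_cvg (h := fun n => radial_step n)).
  exact: measurable_radial_step.
by move=> y _; exact: cvg_radial_step.
Qed.

Lemma cvg_integral_radial_step (D : set R) : measurable D ->
  mu.-integrable D (EFin \o @limit_pdf R) /\
  (\int[mu]_(y in D) (radial_step n y)%:E @[n --> \oo] -->
   \int[mu]_(y in D) (limit_pdf y)%:E)%E.
Proof.
move=> mD.
have [] := @dominated_convergence _ _ _ mu D mD
  (fun n y => (radial_step n y)%:E) (fun y => (limit_pdf y)%:E)
  (fun y => ((limit_const * (8 * expR 5))%:E * (exponential_pdf 1 y)%:E)%E).
- move=> n; apply/measurable_EFinP; apply: measurable_funTS.
  exact: measurable_radial_step.
- by apply/measurable_EFinP; apply: measurable_funTS; exact: measurable_limit_pdf.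
- by apply/aeW => y _; apply: cvg_EFin; [exact: nearW|exact: cvg_radial_step].
- apply: integrableZl => //; apply: (integrableS measurableT) => //.
  exact: integrable_exponential_pdf.
- apply/aeW => y n _ /=; rewrite ger0_norm ?radial_step_ge0// -EFinM lee_fin.
  exact: radial_step_le.
by move=> ? _ ?; split.
Qed.

End radial_step.

(** * Total mass of the limit density *)

Section limit_probability.
Variable R : realType.
Local Notation mu := (@lebesgue_measure R).

(** The full centered normal density of standard deviation 1 / 2; its double has mass 1 on the
    half-line. *)
Let halfnormal (x : R) : R := Num.sqrt (2 / pi) * expR (- (2 * x ^+ 2)).

Let halfnormalE : halfnormal = normal_pdf 0 (1 / 2).
Proof.
rewrite normal_pdfE ?gt_eqF ?divr_gt0//; apply/funext => x.
rewrite /halfnormal /normal_peak /normal_fun subr0 -sqrtrV; last first.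
  by rewrite mulrn_wge0// mulr_ge0 ?sqr_ge0 ?pi_ge0.
have pi0 : pi != 0 :> R by rewrite gt_eqF ?pi_gt0.
congr (Num.sqrt _ * expR _); first by move: (@pi R) pi0 => p p0; field.
by field.
Qed.

Let halfnormal_ge0 x : 0 <= halfnormal x.
Proof. by rewrite mulr_ge0 ?sqrtr_ge0 ?expR_ge0. Qed.

Let continuous_halfnormal : continuous halfnormal.
Proof.
by rewrite halfnormalE; apply: continuous_normal_pdf; rewrite gt_eqF ?divr_gt0.
Qed.

Let integral_halfnormal :
  (\int[mu]_(x in `[0%R, +oo[) (2 * halfnormal x)%:E = 1)%E.
Proof.
under eq_integral do rewrite EFinM.
rewrite ge0_integralZl//=; last 2 first.
- apply/measurable_EFinP/measurable_funTS; exact: continuous_measurable_fun.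
- by move=> x _; rewrite lee_fin.
have := @ge0_symfun_integralT R halfnormal halfnormal_ge0 continuous_halfnormal.
have -> : (\int[mu]_x (halfnormal x)%:E = 1)%E.
  by rewrite halfnormalE; exact: integral_normal_pdf.
rewrite -set_itvcy => -> //.
by move=> x /=; rewrite /halfnormal sqrrN.
Qed.

(** Chosen so that C exp(- x) dominates both [halfnormal x] and [x * halfnormal x]. *)
Let C : R := Num.sqrt (2 / pi) * expR 1.

Let C_ge0 : 0 <= C. Proof. by rewrite mulr_ge0 ?sqrtr_ge0 ?expR_ge0. Qed.

Let halfnormal_le x : halfnormal x <= C * expR (- x).
Proof.
rewrite /halfnormal /C -mulrA ler_wpM2l ?sqrtr_ge0// -expRD ler_expR.
have := sqr_ge0 (x - 1 / 2); have := sqr_ge0 x; nra.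
Qed.

Let mul_halfnormal_le x : x * halfnormal x <= C * expR (- x).
Proof.
rewrite /halfnormal /C mulrCA -mulrA ler_wpM2l ?sqrtr_ge0// -expRD.
apply: (@le_trans _ _ (expR x * expR (- (2 * x ^+ 2)))).
  by rewrite ler_wpM2r ?expR_ge0// (le_trans _ (expR_ge1Dx x))// lerDr.
rewrite -expRD ler_expR; have := sqr_ge0 (x - 1); have := sqr_ge0 x; nra.
Qed.

(* On the half-line limit_pdf = 8 x^2 halfnormal, and the derivative of
   - 2 x halfnormal is 8 x^2 halfnormal - 2 halfnormal. The exponential term
   makes that derivative nonnegative, as the fundamental theorem of calculus on
   [0, +oo[ requires. *)
Let F (x : R) : R := - (2 * C * expR (- x)) - 2 * x * halfnormal x.
Let f (x : R) : R :=
  2 * C * expR (- x) + 8 * x ^+ 2 * halfnormal x - 2 * halfnormal x.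

Let is_derive_F (x : R) : is_derive x 1 F (f x).
Proof.
rewrite /F /f /halfnormal.
apply: is_derive_eq.
rewrite /GRing.scale/= /GRing.scale/=.
by move: (Num.sqrt (2 / pi)) => c; ring.
Qed.

Let cvg_F : F x @[x --> +oo] --> (0 : R).
Proof.
have c0 (k : R) : k * expR (- x) @[x --> +oo] --> (0 : R).
  by rewrite -(mulr0 k); apply: cvgM; [exact: cvg_cst|exact: cvgr_expR].
rewrite -(subr0 0) -{1}oppr0; apply: cvgB; first by apply: cvgN; exact: c0.
apply: (@squeeze_cvgr _ _ _ _ (fun=> 0) (fun x => 2 * C * expR (- x))).
- near=> x; have x0 : 0 <= x by near: x; exact: nbhs_pinfty_ge.
  apply/andP; split; first by rewrite !mulr_ge0.
  by rewrite -(mulrA 2 x) -(mulrA 2 C) ler_wpM2l.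
- exact: cvg_cst.
- exact: c0.
Unshelve. all: by end_near. Qed.

Lemma integral_limit_pdf_itv :
  (\int[mu]_(x in `[0%R, +oo[) (limit_pdf x)%:E = 1)%E.
Proof.
have cexpN : continuous (fun x : R => expR (- x)).
  move=> x; apply: continuous_comp; first exact: opp_continuous.
  exact: continuous_expR.
have cf : continuous f.
  move=> x; apply: cvgB; last first.
    by apply: cvgM; [exact: cvg_cst|exact: continuous_halfnormal].
  apply: cvgD; first by apply: cvgM; [exact: cvg_cst|exact: cexpN].
  apply: cvgM; last exact: continuous_halfnormal.
  by apply: cvgM; [exact: cvg_cst|exact: sqr_continuous].
have f0 x : 0 <= f x.
  rewrite /f addrAC; apply: addr_ge0; last by rewrite mulr_ge0// mulr_ge0 ?sqr_ge0.
  by rewrite subr_ge0 -mulrA ler_wpM2l//; exact: halfnormal_le.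
have Ff : (\int[mu]_(x in `[0%R, +oo[) (f x)%:E = (2 * C)%:E)%E.
  rewrite (@ge0_continuous_FTC2y _ f F 0 0)//.
  - by rewrite /F mulr0 mul0r subr0 oppr0 expR0 mulr1 sub0e EFinN oppeK.
  - exact: continuous_subspaceT.
  - apply: cvg_at_right_filter; apply: differentiable_continuous.
    by apply/derivable1_diffP; have [] := is_derive_F 0.
  - by move=> x _; rewrite derive1E; have [_ ->] := is_derive_F x.
(* Every term is moved to the side where it is nonnegative, so that both integrals split. The known
   values are 2C for f, 2C for the exponential and 1 for the normal term. *)
have E : (\int[mu]_(x in `[0%R, +oo[) (limit_pdf x + 2 * C * expR (- x))%:E =
    \int[mu]_(x in `[0%R, +oo[) (f x + 2 * halfnormal x)%:E)%E.
  apply: eq_integral => x; rewrite mem_setE in_itv/= andbT => x0; congr EFin.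
  rewrite /limit_pdf x0 /f /halfnormal mulNr; ring.
have mE (g : R -> R) D : continuous g ->
    measurable_fun (D : set R) (fun x => (g x)%:E).
  move=> cg; apply/measurable_EFinP/measurable_funTS.
  exact: continuous_measurable_fun.
have Eexp :
    (\int[mu]_(x in `[0%R, +oo[) (2 * C * expR (- x))%:E = (2 * C)%:E)%E.
  rewrite (@ge0_continuous_FTC2y _ _ (fun x => - (2 * C * expR (- x))) 0 0)//.
  - by rewrite oppr0 expR0 mulr1 sub0e EFinN oppeK.
  - by move=> x _; rewrite !mulr_ge0 ?expR_ge0.
  - apply: continuous_subspaceT => x.
    by apply: cvgM; [exact: cvg_cst|exact: cexpN].
  - rewrite -oppr0 -(mulr0 (2 * C)); apply: cvgN.
    by apply: cvgM; [exact: cvg_cst|exact: cvgr_expR].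
  - apply: cvg_at_right_filter; apply: cvgN.
    by apply: cvgM; [exact: cvg_cst|exact: cexpN].
  - move=> x _; rewrite derive1E derive_val /GRing.scale/= /GRing.scale/=; ring.
move: E; under eq_integral do rewrite EFinD.
under [in RHS]eq_integral do rewrite EFinD.
rewrite !ge0_integralD//=; last 8 first.
- by move=> x _; rewrite lee_fin f0.
- exact: mE.
- by move=> x _; rewrite lee_fin mulr_ge0.
- by apply: mE => x; apply: cvgM; [exact: cvg_cst|exact: continuous_halfnormal].
- by move=> x _; rewrite lee_fin limit_pdf_ge0.
- by apply/measurable_EFinP/measurable_funTS; exact: measurable_limit_pdf.
- by move=> x _; rewrite lee_fin !mulr_ge0 ?expR_ge0.
- by apply: mE => x; apply: cvgM; [exact: cvg_cst|exact: cexpN].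
rewrite Eexp Ff integral_halfnormal [RHS]addeC.
by move=> /(congr1 (fun z => z - (2 * C)%:E)%E); rewrite !addeK.
Qed.

Lemma integral_limit_pdf : (\int[mu]_x (limit_pdf x)%:E = 1)%E.
Proof.
rewrite -integral_limit_pdf_itv [RHS]integral_mkcond.
apply: eq_integral => x _; rewrite patchE mem_setE in_itv/= andbT.
by case: leP => // x0; rewrite limit_pdf_lt0.
Qed.

End limit_probability.

(** * The limit law *)

Definition limit_prob (R : realType) (A : set R) : \bar R :=
  (\int[lebesgue_measure]_(x in A) (limit_pdf x)%:E)%E.

Section limit_prob.
Variable R : realType.

Let limit_prob0 : limit_prob (set0 : set R) = 0%E.
Proof. by rewrite /limit_prob integral_set0. Qed.

Let limit_prob_ge0 (A : set R) : (0 <= limit_prob A)%E.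
Proof. by apply: integral_ge0 => x _; rewrite lee_fin limit_pdf_ge0. Qed.

Let limit_prob_sigma_additive : semi_sigma_additive (@limit_prob R).
Proof.
move=> /= A mA tA mUA; rewrite /limit_prob/= integral_bigcup//=; last first.
  by have [] := @cvg_integral_radial_step R _ mUA.
apply: is_cvg_ereal_nneg_natsum_cond => n _ _; exact: limit_prob_ge0.
Qed.

HB.instance Definition _ := isMeasure.Build _ _ _
  (@limit_prob R) limit_prob0 limit_prob_ge0 limit_prob_sigma_additive.

Let limit_prob_setT : limit_prob [set: R] = 1%E.
Proof. exact: integral_limit_pdf. Qed.

HB.instance Definition _ :=
  @Measure_isProbability.Build _ _ R (@limit_prob R) limit_prob_setT.

End limit_prob.

Section limit_variable.
Variable R : realType.

Definition limit_variable (x : R) : R := x.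

Lemma measurable_limit_variable : measurable_fun [set: R] limit_variable.
Proof. exact: measurable_id. Qed.

HB.instance Definition _ := isMeasurableFun.Build _ _ _ _
  limit_variable measurable_limit_variable.

Definition limit_RV : {RV (@limit_prob R) >-> R} := limit_variable.

Lemma limit_RV_pdf : has_pdf limit_RV limit_pdf.
Proof.
split.
- exact: measurable_limit_pdf.
- exact: limit_pdf_ge0.
- by move=> A mA.
Qed.

End limit_variable.

(** * Distribution function of the majority score *)

Definition word_prob (R : realType) n (Q : pred (seq bool)) : R :=
  (\sum_(u : n.-tuple bool) Q u)%N%:R / 2 ^+ n.

Lemma probability_uniform_word (R : realType) (d : measure_display)
    (T : measurableType d) (P : probability T R) n
    (w : {RV P >-> n.-tuple bool}) (Q : pred (seq bool)) :
  uniform_word w -> P [set x | Q (w x)] = (word_prob R n Q)%:E.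
Proof.
move=> unif; pose s := enum (fun u : n.-tuple bool => Q u).
have -> : [set x | Q (w x)] = \bigcup_(u in [set` s]) (w @^-1` [set u]).
  apply/seteqP; split=> [x Qx|x [u /= us xu]]; last first.
    by move: us; rewrite xu mem_enum.
  by exists (w x) => //=; rewrite mem_enum.
rewrite measure_fin_bigcup//=; first last.
- move=> u _; rewrite -[X in measurable X]setTI.
  by apply: measurable_funPT => //; exact: measurable_tuple_bool.
- by move=> u v _ _ [x /= [xu xv]]; rewrite -xu -xv.
rewrite -fsbig_seq ?enum_uniq// (eq_bigr (fun=> (2 ^- n)%:E)); last first.
  by move=> u _; exact: unif.
rewrite sumEFin; congr EFin.
rewrite big_const_seq iter_addr_0 count_predT -[LHS]mulr_natl.
congr (_%:R * _); rewrite -cardE -sum1_card big_mkcond/=.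
by apply: eq_bigr => u _; rewrite unfold_in; case: (Q u).
Qed.

Definition step_integral (R : realType) n (D : set R) : R :=
  fine (\int[lebesgue_measure]_(y in D) (radial_step n y)%:E)%E.

(** For n > 0, the integral of [radial_step] over the cell of index i, whose width is 1 / sqrt n. *)
Definition cell_mass (R : realType) n i : R :=
  limit_const R * radial_weight R n i / Num.sqrt n%:R.


Section majority_cdf.
Variable R : realType.
Variables (n : nat) (tau : nat -> seq bool -> bool).
Hypothesis n_gt0 : (0 < n)%N.

Let score (u : n.-tuple bool) := majority_score (tau (count id u)) u.

(** A score c with 2c < n is taken by no word, since the factor [c.*2.+1 - n] is then zero. *)
Let score_ge u : (uphalf n <= score u)%N.
Proof.
rewrite leqNgt; apply/negP => un.
have := sum_majority_score_sqr n (score u) tau.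
rewrite (_ : (score u).*2.+1 - n = 0)%N ?mul0n ?muln0; last by lia.
move/eqP; rewrite muln_eq0/= sum_nat_eq0 => /forallP/(_ u).
by rewrite eqxx.
Qed.

Let score_le u : (score u <= n)%N.
Proof.
rewrite /score /majority_score -[leqRHS](size_tuple u) -[leqRHS]muln1.
rewrite -[X in (_ <= X * _)%N]subn0 -sum_nat_const_nat.
by apply: leq_sum => t _; exact: leq_b1.
Qed.

Let scale : R := n%:R * 'C(n.+1, (uphalf n).+1)%:R / n.+1%:R.

Let count_score i : (\sum_u (score u == uphalf n + i))%N%:R =
  scale * radial_weight R n i.
Proof.
have := sum_majority_score_sqr n (uphalf n + i) tau => /(congr1 (fun k => k%:R : R)).
rewrite natrM => E.
apply: (@mulfI _ n.+1%:R); first by rewrite pnatr_eq0.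
rewrite E natrM /scale /radial_weight /bin_ratio.
have -> : ((uphalf n + i).*2.+1 - n = i.*2.+1 + odd n)%N by lia.
have c0 : 'C(n.+1, (uphalf n).+1)%:R != 0 :> R.
  by rewrite pnatr_eq0 -lt0n bin_uphalf_gt0.
have n0 : n%:R != 0 :> R by rewrite pnatr_eq0 -lt0n.
have n1 : n.+1%:R != 0 :> R by rewrite pnatr_eq0.
by move: n.+1%:R n1 => N N0; field; rewrite N0 c0 n0.
Qed.

Let count_score_pred (Q : pred nat) :
  (\sum_u Q (score u))%N%:R =
  scale * \sum_(i < n.+1 | Q (uphalf n + i)%N) radial_weight R n i.
Proof.
rewrite mulr_sumr; under [RHS]eq_bigr => i _ do rewrite -(count_score i).
rewrite -natr_sum exchange_big/=; congr _%:R; apply: eq_bigr => u _.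
have un : (score u - uphalf n < n.+1)%N by have := score_le u; lia.
have hu := score_ge u.
rewrite (bigID (fun i : 'I_n.+1 => i == Ordinal un))/=.
rewrite [X in (_ + X)%N]big1 ?addn0; last first.
  move=> i /andP[_ iu]; case: eqP => // ui; case/eqP: iu; apply/val_inj => /=; lia.
have E : (uphalf n + (score u - uphalf n) = score u)%N by rewrite subnKC.
case: (boolP (Q (score u))) => Qu.
  rewrite (big_pred1 (Ordinal un))/= ?E ?eqxx// => i /=.
  by case: eqP => [->|]; rewrite ?andbF//= E Qu.
by rewrite big_pred0// => i; case: eqP => [->|]; rewrite ?andbF//= E (negbTE Qu).
Qed.

Let half_le : (uphalf n)%:R <= (n%:R + 1) / 2 :> R.
Proof. by rewrite ler_pdivlMr// -natrM natr1 ler_nat; lia. Qed.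

Let half_ge : n%:R / 2 <= (uphalf n)%:R :> R.
Proof. by rewrite ler_pdivrMr// -natrM ler_nat; lia. Qed.

Let s : R := Num.sqrt n%:R.

Let s_gt0 : 0 < s. Proof. by rewrite sqrtr_gt0 ltr0n. Qed.

Let measure_cell i : lebesgue_measure (@cell R n i) = (s^-1)%:E.
Proof.
rewrite /cell lebesgue_measure_itv/= lte_fin ltr_pM2r ?invr_gt0// ltr_nat leqnn.
by rewrite -EFinB -mulrBl -natrB// subSnn mul1r.
Qed.

Let weight_ge0 i : 0 <= limit_const R * radial_weight R n i.
Proof. by rewrite mulr_ge0 ?radial_weight_ge0// ltW ?limit_const_gt0. Qed.

Let cell_mass_ge0 i : 0 <= cell_mass R n i.
Proof. by apply: divr_ge0 => //; exact: ltW. Qed.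

Lemma integralT_radial_step :
  (\int[lebesgue_measure]_y (radial_step n y)%:E =
   (\sum_(i < n.+1) cell_mass R n i)%:E)%E.
Proof.
rewrite integral_radial_step// -sumEFin; apply: eq_bigr => i _.
by rewrite setIT measure_cell -EFinM.
Qed.

(** A cell that meets the half-line has i <= x sqrt n, hence [uphalf n + i] <= t, and its full mass
    is counted on the right. *)
Lemma integral_radial_step_le (x t : R) : x * s <= t - (n%:R + 1) / 2 ->
  (\int[lebesgue_measure]_(y in `]-oo, x]) (radial_step n y)%:E <=
   (\sum_(i < n.+1 | (uphalf n + i)%N%:R <= t) cell_mass R n i)%:E)%E.
Proof.
move=> xt; rewrite integral_radial_step// [in leRHS]big_mkcond -sumEFin.
apply: lee_sum => i _; case: ifPn => it.
  rewrite [leRHS]EFinM -(measure_cell i).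
  apply: lee_wpmul2l; first by rewrite lee_fin.
  apply: le_measure => //; rewrite inE; last exact: measurable_itv.
  by apply: measurableI; exact: measurable_itv.
rewrite [X in lebesgue_measure X](_ : _ = set0) ?measure0 ?mule0//.
rewrite -subset0 => y [] /=; rewrite !in_itv/= => /andP[+ _] yx.
rewrite bnd_simp ler_pdivrMr// -/s => iy; apply/negP: it; rewrite natrD.
have : y * s <= x * s by rewrite ler_pM2r.
by move: half_le xt iy; lra.
Qed.

(** If [uphalf n + i] <= t then i + 1 <= x sqrt n, so the whole cell lies in the half-line. *)
Lemma integral_radial_step_ge (x t : R) : t - n%:R / 2 + 1 <= x * s ->
  ((\sum_(i < n.+1 | (uphalf n + i)%N%:R <= t) cell_mass R n i)%:E <=
   \int[lebesgue_measure]_(y in `]-oo, x]) (radial_step n y)%:E)%E.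
Proof.
move=> xt; rewrite integral_radial_step// [in leLHS]big_mkcond -sumEFin.
apply: lee_sum => i _; case: ifPn => it; last first.
  by apply: mule_ge0; rewrite ?lee_fin ?weight_ge0.
rewrite [leLHS]EFinM -(measure_cell i) setIidl// => y /=.
rewrite !in_itv/= => /andP[_].
rewrite bnd_simp ltr_pdivlMr// -/s -natr1 => yi.
rewrite -(@ler_pM2r _ s)//; move: it; rewrite natrD.
by move: half_ge xt yi; lra.
Qed.

Let total_gt0 : 0 < \sum_(i < n.+1) cell_mass R n i.
Proof.
rewrite big_ord_recl ltr_pwDl//; last first.
  by apply: sumr_ge0.
rewrite divr_gt0// mulr_gt0 ?limit_const_gt0// /radial_weight bin_ratio0 mulr1.
by rewrite divr_gt0// ltr0n// expn_gt0.
Qed.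

Lemma word_prob_score (Q : pred nat) :
  word_prob R n (fun u => Q (majority_score (tau (count id u)) u)) =
  (\sum_(i < n.+1 | Q (uphalf n + i)%N) cell_mass R n i) /
  \sum_(i < n.+1) cell_mass R n i.
Proof.
apply/(@mulIf _ (\sum_(i < n.+1) cell_mass R n i)); first by rewrite gt_eqF.
rewrite divfK ?gt_eqF//.
have K (S : pred 'I_n.+1) : \sum_(i < n.+1 | S i) cell_mass R n i =
    limit_const R / s * \sum_(i < n.+1 | S i) radial_weight R n i.
  by rewrite mulr_sumr; apply: eq_bigr => i _; rewrite /cell_mass mulrAC.
rewrite !K.
(* Counting all words expresses 2 ^ n through the same [scale], which therefore cancels. *)
have := count_score_pred predT; rewrite sum1_card card_tuple card_bool natrX => E.
rewrite /word_prob count_score_pred E.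
have E0 : 2 ^+ n != 0 :> R by rewrite expf_neq0.
move: E0; rewrite E /= mulf_eq0 negb_or => /andP[k0 S0].
by move: s_gt0; rewrite lt0r => /andP[s0 _]; field; rewrite s0 k0 S0.
Qed.

Lemma word_prob_score_bounds (x1 x2 t : R) :
  x1 * Num.sqrt n%:R <= t - (n%:R + 1) / 2 ->
  t - n%:R / 2 + 1 <= x2 * Num.sqrt n%:R ->
  step_integral n `]-oo, x1]%classic / step_integral n (@setT R) <=
    word_prob R n (fun u => (majority_score (tau (count id u)) u)%:R <= t) <=
  step_integral n `]-oo, x2]%classic / step_integral n (@setT R).
Proof.
move=> xt1 xt2; set I := @step_integral R n.
have IE D : measurable D ->
    (\int[lebesgue_measure]_(y in D) (radial_step n y)%:E)%E = (I D)%:E.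
  move=> mD; rewrite fineK// ge0_fin_numE; last first.
    by apply: integral_ge0 => y _; rewrite lee_fin radial_step_ge0.
  apply: (@le_lt_trans _ _ (\int[lebesgue_measure]_y (radial_step n y)%:E)%E).
    apply: ge0_subset_integral => //.
    - by apply/measurable_EFinP; exact: measurable_radial_step.
    - by move=> y _; rewrite lee_fin radial_step_ge0.
  by rewrite integralT_radial_step ltry.
have IT : I setT = \sum_(i < n.+1) cell_mass R n i.
  by apply/EFin_inj; rewrite -IE// integralT_radial_step.
rewrite (word_prob_score (fun k => k%:R <= t)) IT.
rewrite !ler_pM2r ?invr_gt0// -!lee_fin -!IE//.
by rewrite integral_radial_step_le// integral_radial_step_ge.
Qed.

End majority_cdf.

(** * From majority scores to correct guesses *)

Lemma word_prob_sub (R : realType) n (Q Q' B : pred (seq bool)) :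
  (forall u : n.-tuple bool, Q u -> Q' u || B u) ->
  word_prob R n Q <= word_prob R n Q' + word_prob R n B.
Proof.
move=> QQ; rewrite /word_prob -mulrDl ler_wpM2r ?invr_ge0 ?exprn_ge0//.
rewrite -natrD ler_nat -big_split/=; apply: leq_sum => u _.
by case: (Q u) (QQ u) => // /(_ isT); case: (Q' u); case: (B u).
Qed.

(** The two kinds of exceptional words number 2 ^ (n - M) and 2 ^ M, and the latter is the smaller
    as 2M <= n. *)
Lemma word_prob_bad (R : realType) n M : (M.*2 <= n)%N ->
  word_prob R n (fun u => all id (take M u) || ~~ has id (drop M u)) <=
  2 * 2^-1 ^+ M.
Proof.
move=> Mn; have nE : n = (M + (n - M))%N by lia.
have p2 k : 0 < 2 ^+ k :> R by rewrite exprn_gt0.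
rewrite /word_prob ler_pdivrMr//; apply: (@le_trans _ _ (2 ^ (n - M) + 2 ^ M)%N%:R).
  rewrite -(@sum_all_take n M) -1?(@sum_hasN_drop n M); try lia.
  rewrite ler_nat -big_split/=; apply: leq_sum => u _.
  by case: all => /=; case: has.
have -> : 2 * 2^-1 ^+ M * 2 ^+ n = (2 * 2 ^ (n - M))%N%:R :> R.
  have -> : 2 ^+ n = 2 ^+ M * 2 ^+ (n - M) :> R by rewrite -exprD -nE.
  by rewrite natrM natrX exprVn -mulrA mulKf// expf_neq0.
rewrite ler_nat mul2n -addnn leq_add2l leq_exp2l//; lia.
Qed.

Lemma cvg_step_integral (R : realType) (D : set R) : measurable D ->
  step_integral n D @[n --> \oo] --> fine (limit_prob D).
Proof.
move=> mD; have [] := @cvg_integral_radial_step R D mD => iD H.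
apply: (@fine_cvg _ _ _ _ (fun n =>
  \int[lebesgue_measure]_(y in D) (radial_step n y)%:E)%E).
by rewrite fineK//; exact: integrable_fin_num.
Qed.

Theorem theorem5 (R : realType)
    (d : nat -> measure_display) (T : forall n : nat, measurableType (d n))
    (P : forall n : nat, probability (T n) R)
    (w : forall n : nat, {RV (P n) >-> n.-tuple bool})
    (w_uniform : forall n : nat, uniform_word (w n))
    (tie : nat -> seq nat -> bool) :
  exists (d' : measure_display) (T' : measurableType d')
    (Q : probability T' R) (G : {RV Q >-> R}),
    has_pdf G limit_pdf /\
    cvg_in_distribution
      (fun n : nat => normalized_correct (w n) (tie n) : {RV (P n) >-> R}) G.
Proof.
exists _, _, (@limit_prob R), (limit_RV R); split; first exact: limit_RV_pdf.
move=> x cdf_x.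
pose F y : R := fine (cdf (limit_RV R) y).
have FE y : cdf (limit_RV R) y = (F y)%:E.
  by rewrite fineK// /cdf fin_num_measure.
have Fx : F y @[y --> x] --> F x.
  by apply: fine_cvg; rewrite -FE; exact: cdf_x.
pose t n y : R := n%:R / 2 + y * Num.sqrt n%:R.
pose correct n : pred (seq bool) :=
  fun u => (correct_guesses (tie n) (riffle u))%:R <= t n x.
(* For n > 0 the division by sqrt n can be undone, and the event becomes a condition on the word
   alone. *)
have cdfE : \forall n \near \oo, (word_prob R n (correct n))%:E =
    cdf (normalized_correct (w n) (tie n) : {RV (P n) >-> R}) x.
  near=> n.
  have n0 : (0 < n)%N by near: n; exact: nbhs_infty_gt.
  rewrite -(probability_uniform_word (correct n) (w_uniform n)) /cdf /distribution.
  congr (P n _); apply/seteqP; rewrite /correct /t; split=> z /=;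
    rewrite in_itv/= /normalized_correct /num_correct ler_pdivrMr ?sqrtr_gt0 ?ltr0n//;
    by rewrite lerBlDr addrC.
rewrite FE; apply: cvg_trans; first exact: near_eq_cvg cdfE.
apply: cvg_EFin; first exact: nearW.
apply/cvgrPdist_le => e e0.
(* The guesser's tie rule read on letters; the labels of the b's depend on the cut k, hence the
   extra argument. *)
pose tau n k h := tie n (fill 1 k.+1 h).
pose score n : seq bool -> nat := fun u => majority_score (tau n (count id u)) u.
have [M Me] : exists M, 2 * 2^-1 ^+ M <= e / 4.
  have : 2 * 2^-1 ^+ M @[M --> \oo] --> (0 : R).
    rewrite -(mulr0 2); apply: cvgM; first exact: cvg_cst.
    by apply: cvg_expr; rewrite ger0_norm// invf_lt1// ltr1n.
  have e4 : 0 < e / 4 by rewrite divr_gt0.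
  move=> /cvgrPdist_le/(_ _ e4)[M _ /(_ M (leqnn M))].
  by rewrite /= sub0r normrN ger0_norm ?mulr_ge0 ?exprn_ge0//; exists M.
have [a a0 Fa] : exists2 a, 0 < a &
    `|F x - F (x - a)| <= e / 4 /\ `|F x - F (x + a)| <= e / 4.
  have e4 : 0 < e / 4 by rewrite divr_gt0.
  move: Fx => /cvgrPdist_le/(_ _ e4)/nbhs_ballP[a /= a0 aF].
  exists (a / 2); first by rewrite divr_gt0.
  by split; apply: aF; rewrite /ball/= ?opprD ?opprK addrA subrr ?add0r ?normrN
    gtr0_norm ?divr_gt0// ltr_pdivrMr// ltr_pMr// ltr1n.
have ratio y : step_integral n `]-oo, y]%classic / step_integral n (@setT R)
    @[n --> \oo] --> F y.
  rewrite -[F y]divr1; apply: cvgM; first exact: cvg_step_integral.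
  apply: cvgV => //.
  have := @cvg_step_integral R setT measurableT.
  by rewrite probability_setT.
near=> n.
have n0 : (0 < n)%N by near: n; exact: nbhs_infty_gt.
have Mn : (M.*2 <= n)%N by near: n; exact: nbhs_infty_ge.
(* A shift of x by a moves the threshold by a sqrt n, which absorbs the score difference M and a
   rounding error of at most 1. *)
have Mna : (M%:R + 1) / a <= Num.sqrt n%:R.
  by near: n; have /cvgryPge := @cvg_sqrt_natr R; apply.
have lo : `|F (x - a) -
    step_integral n `]-oo, x - a]%classic / step_integral n (@setT R)| <= e / 4.
  by near: n; have /cvgrPdist_le := ratio (x - a); apply; rewrite divr_gt0.
have hi : `|F (x + a) -
    step_integral n `]-oo, x + a]%classic / step_integral n (@setT R)| <= e / 4.
  by near: n; have /cvgrPdist_le := ratio (x + a); apply; rewrite divr_gt0.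
have sM : M%:R + 1 <= a * Num.sqrt n%:R by rewrite mulrC -ler_pdivrMr.
have bad := le_trans (word_prob_bad R Mn) Me.
have close (u : n.-tuple bool) :
    ~~ (all id (take M u) || ~~ has id (drop M u)) ->
    (correct_guesses (tie n) (riffle u) <= score n u + M /\
     score n u <= correct_guesses (tie n) (riffle u) + M)%N.
  rewrite negb_or negbK => /andP[h1 h2].
  by apply: correct_guesses_close => //; rewrite size_tuple (leq_trans _ Mn)// -addnn
    leq_addr.
have h1 : word_prob R n (correct n) <=
    word_prob R n (fun u => (score n u)%:R <= t n x + M%:R) + e / 4.
  apply: (le_trans _ (lerD (lexx _) bad)); apply: word_prob_sub => u.
  rewrite /correct.
  case: (boolP (all id (take M u) || ~~ has id (drop M u))) => [_|/close[_ h]].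
    by rewrite orbT.
  rewrite orbF => h3; apply: (le_trans _ (lerD h3 (lexx _))).
  by rewrite -natrD ler_nat.
have h2 : word_prob R n (fun u => (score n u)%:R <= t n x - M%:R) <=
    word_prob R n (correct n) + e / 4.
  apply: (le_trans _ (lerD (lexx _) bad)); apply: word_prob_sub => u.
  rewrite /correct.
  case: (boolP (all id (take M u) || ~~ has id (drop M u))) => [_|/close[h _]].
    by rewrite orbT.
  rewrite orbF lerBrDr => h3; apply: (le_trans _ h3).
  by rewrite -natrD ler_nat.
have b1 := @word_prob_score_bounds R n (tau n) n0 (x - a) (x + a) (t n x - M%:R).
have b2 := @word_prob_score_bounds R n (tau n) n0 (x - a) (x + a) (t n x + M%:R).
have M0 : 0 <= M%:R :> R by [].
have /andP[l1 _] := b1 ltac:(rewrite /t; clear -sM M0; lra)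
  ltac:(rewrite /t; clear -sM M0; lra).
have /andP[_ l2] := b2 ltac:(rewrite /t; clear -sM M0; lra)
  ltac:(rewrite /t; clear -sM M0; lra).
have [Fa1 Fa2] := Fa.
have := le_trans h1 (lerD l2 (lexx _)); have := le_trans l1 h2.
(* Exceptional words, continuity of F and convergence of the quotients cost e / 4 each. *)
move: lo hi Fa1 Fa2; rewrite !ler_norml.
clear; do 4![move=> /andP[? ?]]; move=> ? ? /=.
by apply/andP; split; lra.
Unshelve. all: by end_near. Qed.
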